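(* Let $n\ge 2$ be an integer. For any $(\gamma,c)\in\operatorname{BS}(1,n)=\mathbb{Z}\left[\tfrac1n\right]\rtimes\mathbb{Z}$, $e\text{-}\operatorname{Stab}\big((\gamma,c)\big)=e\text{-}\operatorname{Stab}\big((\gamma,c)^k\big)$ for all $k\in\mathbb{Z}$.
   Context: $\mathbb{Z}\left[\tfrac1n\right]=\{l/n^j\mid l\in\mathbb{Z},j\ge 0\}\subset\mathbb{Q}$ (as an additive group). The Baumslag--Solitar group $\operatorname{BS}(1,n)=\langle a,t\mid tat^{-1}=a^n\rangle$ is identified with the set of pairs $(\gamma,c)$, $\gamma\in\mathbb{Z}\left[\tfrac1n\right]$, $c\in\mathbb{Z}$, with product $(\gamma_1,c_1)(\gamma_2,c_2)=(\gamma_1n^{c_2}+\gamma_2,\;c_1+c_2)$. For a group $G$ and $g\in G$, $e\text{-}\operatorname{Stab}(g)=\{\varphi\in\operatorname{End}(G)\mid\varphi(g)=g\}$, where $\operatorname{End}(G)$ is the monoid of endomorphisms of $G$.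
   Formalization: The formal statement takes k to be a nonzero integer; for k = 0 the claim fails, since the power is the identity, fixed by every endomorphism, while the trivial endomorphism does not fix e.g. (0,1). *)

(* Defs.v *)
From HB Require Import structures.
From mathcomp Require Import all_boot all_order all_algebra.
From mathcomp Require Import boolp classical_sets.

Set Implicit Arguments.
Unset Strict Implicit.
Unset Printing Implicit Defensive.

Import Order.TTheory GRing.Theory Num.Theory.

Local Open Scope ring_scope.

(* Membership in Z[1/n] as a subset of the rationals. The boolean reflection
   makes membership proof-irrelevant, so that Z[1/n] is a subtype of rat. *)
Definition is_Zinv (n : nat) : {pred rat} :=
  fun x => `[< exists (l : int) (j : nat), x = l%:~R / n%:R ^+ j >].

Lemma is_ZinvP (n : nat) (x : rat) :
  reflect (exists (l : int) (j : nat), x = l%:~R / n%:R ^+ j) (x \in is_Zinv n).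
Proof. exact: asboolP. Qed.

Lemma Zinv_zmod_closed (n : nat) : zmod_closed (is_Zinv n).
Proof.
split=> [|x y]; first by apply/is_ZinvP; exists 0, 0%N; rewrite mul0r.
case: n => [|n].
  have int0 z : z \in is_Zinv 0 -> exists l : int, z = l%:~R.
    case/is_ZinvP=> l [[|j]] ->; first by exists l; rewrite expr0 divr1.
    by exists 0; rewrite exprS mul0r invr0 mulr0.
  case/int0=> l -> /int0[m ->]; apply/is_ZinvP; exists (l - m), 0%N.
  by rewrite expr0 divr1 intrB.
case/is_ZinvP=> l [i ->] /is_ZinvP[m [j ->]]; apply/is_ZinvP.
exists (l * n.+1%:Z ^+ j - m * n.+1%:Z ^+ i), (i + j)%N.
rewrite intrB !intrM !rmorphXn /= -[n.+1%:~R]/(n.+1%:R) exprD.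
have nz k : (n.+1%:R : rat) ^+ k != 0 by rewrite expf_neq0 // pnatr_eq0.
rewrite invfM mulrBl; congr (_ - _).
  by rewrite mulrACA divff ?mulr1.
by rewrite [_^-1 * _^-1]mulrC mulrACA divff ?mulr1.
Qed.

HB.instance Definition _ (n : nat) :=
  GRing.isZmodClosed.Build rat (is_Zinv n) (Zinv_zmod_closed n).

(* The additive group Z[1/n]. *)
Record Zinv (n : nat) : Type :=
  MkZinv { Zinv_val :> rat; Zinv_valP : Zinv_val \in is_Zinv n }.

HB.instance Definition _ (n : nat) := [isSub for @Zinv_val n].
HB.instance Definition _ (n : nat) := [Choice of Zinv n by <:].
HB.instance Definition _ (n : nat) := [SubChoice_isSubZmodule of Zinv n by <:].

Lemma Zinv_act_subproof (n : nat) (g : Zinv n) (c : int) :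
  (g : rat) * n%:R ^ c \in is_Zinv n.
Proof.
case/is_ZinvP: (Zinv_valP g) => l [j ->]; apply/is_ZinvP.
case: c => k.
  exists (l * n%:Z ^+ k), j.
  by rewrite intrM rmorphXn /= mulrAC.
by exists l, (j + k.+1)%N; rewrite exprD invfM mulrA.
Qed.

Definition Zinv_act (n : nat) (g : Zinv n) (c : int) : Zinv n :=
  MkZinv (Zinv_act_subproof g c).

(* The proof hn only serves to make the pairs into a group: for n = 0 the
   product below is still defined, but has no inverses. *)
Definition BS (n : nat) (hn : (2 <= n)%N) : Type := (Zinv n * int)%type.

Section BSGroup.
Variables (n : nat) (hn : (2 <= n)%N).

Definition BS_mul (x y : BS hn) : BS hn :=
  (Zinv_act x.1 y.2 + y.1, x.2 + y.2).

Definition BS_one : BS hn := (0, 0).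

Definition BS_inv (x : BS hn) : BS hn := (- Zinv_act x.1 (- x.2), - x.2).

Let nz : (n%:R : rat) != 0.
Proof. by rewrite pnatr_eq0 -lt0n (leq_trans _ hn). Qed.

Lemma BS_mulA : associative BS_mul.
Proof.
case=> [a c] [b d] [e f]; congr pair; rewrite /= ?addrA //.
by apply: val_inj; rewrite /= mulrDl expfzDr // mulrA ?addrA.
Qed.

Lemma BS_mul1 : left_id BS_one BS_mul.
Proof.
case=> [a c]; congr pair; rewrite /= ?add0r //.
by apply: val_inj; rewrite /= mul0r add0r.
Qed.

Lemma BS_mulr1 : right_id BS_one BS_mul.
Proof.
case=> [a c]; congr pair; rewrite /= ?addr0 //.
by apply: val_inj; rewrite /= expr0z mulr1.
Qed.

Lemma BS_mulV : left_inverse BS_one BS_inv BS_mul.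
Proof.
case=> [a c]; congr pair; rewrite /= ?addNr //.
by apply: val_inj; rewrite /= mulNr -mulrA -expfzDr // addNr expr0z mulr1 addNr.
Qed.

Lemma BS_mulrV : right_inverse BS_one BS_inv BS_mul.
Proof.
by case=> [a c]; congr pair; rewrite /= subrr.
Qed.

HB.instance Definition _ := Choice.copy (BS hn) (Zinv n * int)%type.
HB.instance Definition _ :=
  isGroup.Build (BS hn) BS_mulA BS_mul1 BS_mulr1 BS_mulV BS_mulrV.

End BSGroup.

(* Integer powers; the library only has natural powers in a groupType. *)
Definition expgz (G : groupType) (g : G) (k : int) : G :=
  match k with
  | Posz m => (g ^+ m)%g
  | Negz m => (g ^- m.+1)%g
  end.

Notation End G := (UMagmaMorphism.type G G).

Definition eStab (G : groupType) (g : G) : set (End G) :=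
  [set phi : End G | phi g = g].

(* Main.v *)
Require Import Defs.
From mathcomp Require Import all_boot all_order all_algebra.
From mathcomp Require Import boolp classical_sets.

(** Roots are unique in BS(1,n): the power [(gamma, c)^m] is
    [(gamma * (1 + n^c + ... + n^((m-1)c)), m c)], and the geometric sum is
    positive, so the power determines first [c] and then [gamma].  An
    endomorphism fixing [g^k] maps [g] to a [k]-th root of [g^k], hence to
    [g]. *)

Set Implicit Arguments.
Unset Strict Implicit.
Unset Printing Implicit Defensive.

Import Order.TTheory GRing.Theory Num.Theory.

Local Open Scope ring_scope.

Lemma expg_BS_snd (n : nat) (hn : (2 <= n)%N) (x : BS hn) (m : nat) :
  (x ^+ m)%g.2 = x.2 *+ m.
Proof.
elim: m => [|m IHm]; first by rewrite expg0 mulr0n.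
by rewrite expgS [LHS]/= IHm mulrS.
Qed.

Lemma expg_BS_fst (n : nat) (hn : (2 <= n)%N) (x : BS hn) (m : nat) :
  Zinv_val (x ^+ m)%g.1 =
  Zinv_val x.1 * \sum_(i < m) (n%:R ^ x.2 : rat) ^+ i.
Proof.
elim: m => [|m IHm]; first by rewrite expg0 big_ord0 mulr0.
(* [expgS] splits off the left factor, whose first coordinate gets scaled by $n^{mc}$: this is the
   top term of the sum. *)
rewrite expgS [LHS]/= IHm expg_BS_snd big_ord_recr /= mulrDr addrC.
by rewrite -[x.2 *+ m]mulr_natr natz -exprz_exp.
Qed.

Lemma BS_expgI (n : nat) (hn : (2 <= n)%N) (m : nat) :
  (0 < m)%N -> injective (fun x : BS hn => (x ^+ m)%g).
Proof.
case: m => // m _ x y exy.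
have e2 : x.2 = y.2.
  by apply: (@pmulrnI int m.+1 isT); rewrite /= -!expg_BS_snd exy.
have sum_gt0 : 0 < \sum_(i < m.+1) (n%:R ^ y.2 : rat) ^+ i.
  have n_gt0 : 0 < n%:R ^ y.2 :> rat by rewrite exprz_gt0 // ltr0n ltnW.
  (* The term of index 0 is 1 and the others are nonnegative. *)
  rewrite big_ord_recl expr0 ltr_pwDl // sumr_ge0 // => i _.
  by rewrite exprn_ge0 // ltW.
have e1 : x.1 = y.1.
  (* By [e2] both powers involve the same geometric sum, which cancels. *)
  apply: val_inj; apply: (mulIf (lt0r_neq0 sum_gt0)).
  by rewrite -[in LHS]e2 /= -!expg_BS_fst exy.
by case: x y e1 e2 {exy sum_gt0} => [? ?] [? ?] /= -> ->.
Qed.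

Lemma gmulf_expgz (G : groupType) (phi : End G) (g : G) (k : int) :
  phi (expgz g k) = expgz (phi g) k.
Proof. by case: k => m; rewrite /= ?gmulfV gmulfXn. Qed.

Lemma BS_expgzI (n : nat) (hn : (2 <= n)%N) (k : int) :
  k <> 0 -> injective (fun x : BS hn => expgz x k).
Proof.
case: k => [[|m]|m] // _ x y /=; first exact: BS_expgI.
(* The exponent [Negz m] gives the inverse of the power [m.+1], and inversion is injective. *)
by move/invg_inj; apply: BS_expgI.
Qed.

Theorem theorem4p11 (n : nat) (hn : (2 <= n)%N) (gamma : Zinv n) (c : int)
    (k : int) (hk : k <> 0%R) :
  eStab ((gamma, c) : BS hn) = eStab (expgz ((gamma, c) : BS hn) k).
Proof.
apply/seteqP; split=> phi; rewrite /eStab /= gmulf_expgz; first by move->.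
exact: BS_expgzI.
Qed.
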